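(* Let $X$ be a continuum and $p\in X$. If $X$ is colocally connected at $p$, then $HS(p,X)$ is colocally connected.
   Context: A continuum is a nondegenerate (more than one point) compact connected metric space. For a continuum $X$, $C(X)$ is the hyperspace of all subcontinua of $X$, i.e. all nonempty closed connected subsets of $X$ (singletons included), with the Hausdorff metric. For $p\in X$, $C(p,X)=\{A\in C(X):p\in A\}$, and $HS(p,X)=C(X)/C(p,X)$ is the quotient space obtained from $C(X)$ by shrinking $C(p,X)$ to a single point. A space $Y$ is colocally connected at $y\in Y$ provided that for each open subset $U$ of $Y$ containing $y$ there exists an open subset $V$ of $Y$ such that $y\in V\subset U$ and $Y-V$ is connected. $Y$ is colocally connected if it is colocally connected at each of its points. *)

(* Defs.v *)
From HB Require Import structures.
From mathcomp Require Import all_boot all_order all_algebra.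
From mathcomp Require Import all_classical all_reals all_analysis.

Set Implicit Arguments.
Unset Strict Implicit.
Unset Printing Implicit Defensive.
Import Order.TTheory GRing.Theory Num.Theory.
Local Open Scope classical_set_scope.
Local Open Scope ring_scope.
Local Open Scope quotient_scope.

HB.mixin Record Metric_isContinuum (R : realType) X & Metric R X := {
  continuum_compact : compact [set: X] ;
  continuum_connected : connected [set: X] ;
  continuum_nondegenerate : exists x y : X, x <> y
}.

#[short(type="continuumType")]
HB.structure Definition Continuum (R : realType) :=
  { X of Metric R X & Metric_isContinuum R X }.

Definition is_subcontinuum (X : topologicalType) (A : set X) : Prop :=
  [/\ A !=set0, closed A & connected A].

(* C(X); its topology is that of the Hausdorff metric, given at the end of
   the section hausdorff_metric. *)
Record hyperspace (X : topologicalType) := Hyperspace {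
  subcontinuum_set :> set X ;
  hyperspaceP : is_subcontinuum subcontinuum_set
}.

HB.instance Definition _ (X : topologicalType) := gen_eqMixin (hyperspace X).
HB.instance Definition _ (X : topologicalType) := gen_choiceMixin (hyperspace X).

Lemma hyperspace_inj (X : topologicalType) :
  injective (@subcontinuum_set X).
Proof.
move=> [A PA] [B PB] /= AB; case: _ / AB in PB *.
by congr Hyperspace; exact: Prop_irrelevance.
Qed.

(* N(e, A) *)
Definition neighborhood_of (R : realType) (X : metricType R) (e : R)
  (A : set X) : set X := [set x | exists2 a, A a & mdist a x < e].

Definition hausdorff_radii (R : realType) (X : metricType R) (A B : set X) :
    set R :=
  [set e | [/\ 0 < e, A `<=` neighborhood_of e B & B `<=` neighborhood_of e A]].

Definition hausdorff_dist (R : realType) (X : metricType R) (A B : set X) : R :=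
  inf (hausdorff_radii A B).

Section hausdorff_metric.
Context {R : realType} {X : continuumType R}.
Implicit Types A B C : hyperspace X.

Let hdist A B : R := hausdorff_dist A B.

Lemma continuum_bounded (a : X) : exists2 e : R, 0 < e & forall x, mdist a x < e.
Proof.
have /compact_near_coveringP/near_covering_withinP cX := @continuum_compact R X.
have := cX nat \oo (fun n x => mdist a x < n%:R) _.
have H : forall x : X, [set: X] x ->
    \forall x' \near x & n \near \oo, [set: X] x' -> mdist a x' < n%:R.
  move=> x _.
  exists (ball x 1, [set n | mdist a x + 1 <= n%:R]) => /=.
    split; first exact: nbhsx_ballx.
    exists (Num.bound (mdist a x + 1)) => // n /= bn.
    apply/ltW/(lt_le_trans (archi_boundP _)); last by rewrite ler_nat.
    by rewrite addr_ge0 ?mdist_ge0.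
  move=> [y n] /= [+ xn] _; rewrite ballEmdist/= => xy.
  apply: lt_le_trans xn; apply: le_lt_trans (metric_triangle a x y) _.
  by rewrite ltrD2l.
move=> /(_ _ H)[N _ /(_ N.+1 (leqnSn _))/= aN].
by exists N.+1%:R => // x; apply: aN.
Qed.

Lemma hausdorff_radii_neq0 A B :
  hausdorff_radii A B !=set0.
Proof.
have [[a Aa] _ _] := hyperspaceP A; have [[b Bb] _ _] := hyperspaceP B.
have [e e0 ae] := continuum_bounded a; have [f f0 bf] := continuum_bounded b.
exists (e + f); split; first exact: addr_gt0.
- by move=> x _; exists b => //; apply: (lt_trans (bf x)); rewrite ltrDr.
- by move=> x _; exists a => //; apply: (lt_trans (ae x)); rewrite ltrDl.
Qed.

Lemma hausdorff_radii_lbound0 A B :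
  lbound (hausdorff_radii A B) 0.
Proof. by move=> e [/ltW]. Qed.

Lemma has_inf_hausdorff_radii A B :
  has_inf (hausdorff_radii A B).
Proof.
split; first exact: hausdorff_radii_neq0.
by exists 0; exact: hausdorff_radii_lbound0.
Qed.

Lemma hausdorff_radii_sym (A B : set X) :
  hausdorff_radii A B = hausdorff_radii B A.
Proof. by apply/seteqP; split=> e [? ? ?]. Qed.

Let hdistxx A : hdist A A = 0.
Proof.
apply/eqP; rewrite eq_le; apply/andP; split; last first.
by apply: lb_le_inf; [exact: hausdorff_radii_neq0 |
                        exact: hausdorff_radii_lbound0].
apply/ler_addgt0Pl => e e0; rewrite addr0.
apply: ge_inf; first by exists 0; exact: hausdorff_radii_lbound0.
by split=> // x Ax; exists x => //; rewrite mdistxx.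
Qed.

Let hdist_sym A B : hdist A B = hdist B A.
Proof. by rewrite /hdist /hausdorff_dist hausdorff_radii_sym. Qed.

Let hdist0_sub A B : hdist A B = 0 -> A `<=` B.
Proof.
move=> AB0 x Ax; have [_ cB _] := hyperspaceP B; apply: cB => U.
rewrite -nbhs_ballE => -[e e0 xeU].
have [d [_ AB _] de] := inf_adherent e0 (has_inf_hausdorff_radii A B).
have [b Bb bx] := AB _ Ax; exists b; split=> //; apply: xeU.
apply: ball_sym; rewrite ballEmdist/=; apply: lt_trans bx _.
by move: de; rewrite -/(hausdorff_dist _ _) -/(hdist A B) AB0 add0r.
Qed.

Let hdist_positivity A B : hdist A B = 0 -> A = B.
Proof.
move=> AB0; apply: hyperspace_inj; apply/seteqP; split; apply: hdist0_sub => //.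
by rewrite hdist_sym.
Qed.

Lemma neighborhood_of_trans (d e : R) (A B C : set X) :
  A `<=` neighborhood_of d B -> B `<=` neighborhood_of e C ->
  A `<=` neighborhood_of (d + e) C.
Proof.
move=> AB BC x /AB[b /BC[c Cc cb] bx]; exists c => //.
by rewrite addrC (le_lt_trans (metric_triangle c b x))// ltrD.
Qed.

Let hdist_triangle B A C : hdist A C <= hdist A B + hdist B C.
Proof.
apply/ler_addgt0Pl => e e0; have e20 : 0 < e / 2 by rewrite divr_gt0.
have [d [d0 AB BA] dlt] := inf_adherent e20 (has_inf_hausdorff_radii A B).
have [f [f0 BC CB] flt] := inf_adherent e20 (has_inf_hausdorff_radii B C).
apply: (@le_trans _ _ (d + f)); last first.
  by rewrite [leRHS]addrC [e in leRHS]splitr addrACA; apply/ltW/ltrD.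
apply: ge_inf; first by exists 0; exact: hausdorff_radii_lbound0.
split; first exact: addr_gt0.
- exact: neighborhood_of_trans AB BC.
- by rewrite addrC; exact: neighborhood_of_trans CB BA.
Qed.

HB.instance Definition _ := @isMetric.Build R (hyperspace X)
  hdist hdistxx hdist_positivity hdist_sym hdist_triangle.

End hausdorff_metric.

(* T / S : the classes are S and the singletons outside S. *)
Definition collapse_rel (T : Type) (S : set T) (x y : T) : bool :=
  `[< x = y \/ S x /\ S y >].

Lemma collapse_rel_is_equiv (T : Type) (S : set T) :
  equiv_class_of (collapse_rel S).
Proof.
split=> [x|x y|y x z]; first by apply/asboolP; left.
- by apply/asboolP/asboolP => -[->|[? ?]]; by [left|right].
- move=> /asboolP[->//|[Sx Sy]] /asboolP[<-|[_ Sz]];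
    by apply/asboolP; right.
Qed.

Canonical collapse_equiv (T : Type) (S : set T) :=
  EquivRelPack (collapse_rel_is_equiv S).

Definition collapse (T : topologicalType) (S : set T) : topologicalType :=
  quotient_topology {eq_quot (collapse_equiv S)}.

(* C(p, X) *)
Definition hyperspace_at (X : topologicalType) (p : X) : set (hyperspace X) :=
  [set A : hyperspace X | (A : set X) p].

Definition HS (R : realType) (X : continuumType R) (p : X) : topologicalType :=
  collapse (hyperspace_at p).

(* [connected] holds of the empty set, so V = Y is allowed; in a T1 space with
   at least two points this does not affect the notion. *)
Definition colocally_connected_at (Y : topologicalType) (y : Y) : Prop :=
  forall U : set Y, open U -> U y ->
  exists V : set Y, [/\ open V, V y, V `<=` U & connected (~` V)].

Definition colocally_connected (Y : topologicalType) : Prop :=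
  forall y : Y, colocally_connected_at y.

(* Main.v *)
Require Import Defs.
From mathcomp Require Import all_boot all_order all_algebra.
From mathcomp Require Import all_classical all_reals all_analysis.

(* Order intervals [A, Y] = {B : A <= B <= Y} of C(X) are connected: in a
   disconnection into closed parts, C(X) being compact, the part missing Y has
   a maximal element M, which boundary bumping enlarges slightly inside Y.
   Consequently C(Z) is connected for every subcontinuum Z.
   At the vertex, take as neighbourhood the continua meeting V, where V is
   given by colocal connectedness at p; its complement is C(X - V).
   At A with p not in A, take a small Hausdorff ball around A.  A continuum B
   outside of it either leaves a neighbourhood of A, as do all larger ones, and
   then [B, X] avoids the ball; or fails to approximate A from above, as do all
   smaller ones, and then [{b}, B] together with the singletons avoids the ball
   (if A is a singleton, the first case always holds).  Both connected sets
   reach the vertex, through X and {p} respectively. *)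

Set Implicit Arguments.
Unset Strict Implicit.
Unset Printing Implicit Defensive.
Import Order.TTheory GRing.Theory Num.Theory.
Local Open Scope classical_set_scope.
Local Open Scope ring_scope.
Local Open Scope quotient_scope.

(** * Separations and metric balls *)

Lemma open_disjoint_separated (T : topologicalType) (U V : set T) :
  open U -> open V -> U `&` V = set0 -> separated U V.
Proof.
move=> oU oV UV0; split; apply/disjoints_subset => x.
- move=> clUx Vx; have [|y] := clUx V; first exact: open_nbhs_nbhs.
  by rewrite UV0.
- move=> Ux clVx; have [|y] := clVx U; first exact: open_nbhs_nbhs.
  by rewrite setIC UV0.
Qed.

(** The closure of either part of a separation stays in the closed set [K] and misses the other
    part. *)
Lemma closed_not_connected (T : topologicalType) (K : set T) :
  closed K -> ~ connected K -> exists P Q : set T,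
    [/\ closed P, closed Q, P !=set0, Q !=set0 & K = P `|` Q /\ P `&` Q = set0].
Proof.
move=> cK /connectedPn[E [E0 KE sE]]; have [sE1 sE2] := sE.
have cE b : closed (E b).
  apply/closure_id/seteqP; split=> [|x Ex]; first exact: subset_closure.
  have : K x.
    by rewrite ((closure_id K).1 cK) KE closureU; case: b Ex; [right|left].
  rewrite KE; case: b Ex => Ex [] // Ex'; exfalso.
  - by rewrite -[False]/(set0 x) -sE2.
  - by rewrite -[False]/(set0 x) -sE1.
exists (E false), (E true); split => //; split => //.
exact: separated_disjoint.
Qed.

Lemma open_metric_ball (R : realType) (T : metricType R) (x : T) (r : R) :
  open (ball x r).
Proof.
rewrite openE => y; rewrite ballEmdist/= => xy.
apply/nbhs_ballP; exists (r - mdist x y) => /=; first by rewrite subr_gt0.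
move=> z; rewrite !ballEmdist/= ltrBrDl; apply: le_lt_trans.
exact: metric_triangle.
Qed.

(** * Quasi-components and boundary bumping *)

Section subcontinua.
Context {R : realType} {X : continuumType R}.
Implicit Types (A B M Y : hyperspace X) (U V W Z : set X).

Lemma continuum_normal : normal_space X.
Proof.
by apply: compact_normal; [exact: metric_hausdorff|exact: continuum_compact].
Qed.

(** By normality the closed parts of a disconnection have disjoint open neighbourhoods, so it
    suffices to test with open sets that are disjoint in all of [X]. *)
Lemma closed_connected (K : set X) :
  closed K ->
  (forall U V, open U -> open V -> U `&` V = set0 -> K `<=` U `|` V ->
    K `&` U !=set0 -> K `&` V !=set0 -> False) ->
  connected K.
Proof.
have /(@normal_openP R X) nT := continuum_normal.
move=> cK KUV; apply: contrapT => /(closed_not_connected cK).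
move=> [P [Q [cP cQ [x Px] [y Qy] [KPQ PQ0]]]].
have [U [V [oU oV PU QV UV0]]] := nT _ _ cP cQ PQ0.
apply: (KUV U V) => //.
- by rewrite KPQ; apply: setUSS.
- by exists x; split; [rewrite KPQ; left|exact: PU].
- by exists y; split; [rewrite KPQ; right|exact: QV].
Qed.

Lemma continuum_closed_compact Z : closed Z -> compact Z.
Proof. by move=> cZ; apply: (subclosed_compact cZ (@continuum_compact R X)). Qed.

(* The clopen subsets of [Z] containing [M]; for closed [Z], a closed [D] is
   clopen in [Z] iff [Z `\` D] is closed. *)
Definition clopen_around Z (M : set X) : set (set X) :=
  [set D | [/\ closed D, closed (Z `\` D), D `<=` Z & M `<=` D]].

Lemma clopen_aroundI Z (M : set X) D E :
  clopen_around Z M D -> clopen_around Z M E -> clopen_around Z M (D `&` E).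
Proof.
move=> [cD cZD DZ MD] [cE cZE EZ ME]; split.
- exact: closedI.
- by rewrite setDIr; exact: closedU.
- by move=> x [/DZ].
- by rewrite subsetI.
Qed.

Definition quasi_component Z (M : set X) : set X :=
  \bigcap_(D in clopen_around Z M) D.

(** Otherwise the closed sets [D] minus [W] form a filter base in the compact set [Z], and a cluster
    point would lie in the quasi-component but outside [W]. *)
Lemma clopen_around_sub Z (M : set X) W : closed Z -> M `<=` Z -> open W ->
  quasi_component Z M `<=` W -> exists2 D, clopen_around Z M D & D `<=` W.
Proof.
move=> cZ MZ oW qW; apply: contrapT => noD.
pose F := filter_from (clopen_around Z M) (fun D => D `\` W).
have ZZ : clopen_around Z M Z by split => //; rewrite setDv; exact: closed0.
have FF : ProperFilter F.
  apply: filter_from_proper; last first.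
    move=> D ZMD; apply/set0P/negP => /eqP; rewrite setD_eq0 => DW.
    by apply: noD; exists D.
  apply: filter_from_filter; first by exists Z.
  move=> D E ZD ZE; exists (D `&` E); first exact: clopen_aroundI.
  by move=> x [[Dx Ex] Wx].
have [|x [Zx Fx]] := continuum_closed_compact cZ FF.
  by exists Z => // x [].
have qx D : clopen_around Z M D -> (D `\` W) x.
  move=> ZMD; have cDW : closed (D `\` W).
    by apply: closedI; [case: ZMD|exact: open_closedC].
  by rewrite ((closure_id _).1 cDW) => V Vx; apply: Fx => //; exists D.
have /qW : quasi_component Z M x by move=> E /qx[].
by have [] := qx _ ZZ.
Qed.

(** If disjoint open [U] and [V] cover the quasi-component, they cover some [D] clopen around [M].
    The connected set [M] lies in one of them, say [U]; then removing [V] from [D] leaves a set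
    clopen around [M], so the quasi-component misses [V]. *)
Lemma quasi_component_connected Z (M : set X) : closed Z -> M `<=` Z ->
  M !=set0 -> connected M -> connected (quasi_component Z M).
Proof.
move=> cZ MZ [m Mm] coM.
apply: closed_connected; first by apply: closed_bigI => D [].
move=> U V oU oV UV0 qUV.
wlog Um : U V oU oV UV0 qUV / U m.
  move=> wl qU qV; have [|Um|Vm] := qUV m; first by move=> D [_ _ _]; apply.
  - exact: (wl U V).
  - by apply: (wl V U) => //; [rewrite setIC|rewrite setUC].
move=> _ [x [qx Vx]].
have [D [cD cZD DZ MD] DUV] := clopen_around_sub cZ MZ (openU oU oV) qUV.
suff /qx[_ /(_ Vx)//] : clopen_around Z M (D `\` V).
have MU : M `<=` U.
  have [|//|] := connected_subset (open_disjoint_separated oU oV UV0) _ coM.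
    exact: subset_trans DUV.
  by move=> /(_ _ Mm) Vm; exfalso; rewrite -[False]/(set0 m) -UV0.
split.
- by apply: closedI => //; exact: open_closedC.
(* Within [D], the part in [V] is the part off [U], which is closed. *)
- have -> : Z `\` (D `\` V) = (Z `\` D) `|` (D `\` U).
    apply/seteqP; split=> y.
    + move=> [Zy DVy]; have [Dy|] := pselect (D y); last by left.
      right; split=> // Uy; apply: DVy; split=> // Vy.
      by rewrite -[False]/(set0 y) -UV0.
    + move=> [[Zy Dy]|[Dy Uy]]; first by split=> // -[].
      by split; [exact: DZ|move=> [_]; apply; case: (DUV _ Dy)].
  by apply: closedU => //; apply: closedI => //; exact: open_closedC.
- by move=> y [/DZ].
- move=> y My; split; first exact: MD.
  by move=> Vy; rewrite -[False]/(set0 y) -UV0; split => //; exact: MU.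
Qed.

Lemma open_neighborhood_of (e : R) (A : set X) : open (neighborhood_of e A).
Proof.
have -> : neighborhood_of e A = \bigcup_(a in A) (ball a e).
  by apply/seteqP; split=> x [a Aa]; rewrite ?ballEmdist/= => ax;
    exists a => //; rewrite ballEmdist.
by apply: bigcup_open => a Aa; exact: open_metric_ball.
Qed.

Lemma sub_neighborhood_of (e : R) (A : set X) : 0 < e -> A `<=` neighborhood_of e A.
Proof. by move=> e0 a Aa; exists a => //; rewrite mdistxx. Qed.

Lemma neighborhood_ofS (d e : R) (A : set X) : d <= e ->
  neighborhood_of d A `<=` neighborhood_of e A.
Proof. by move=> de x [a Aa ax]; exists a => //; exact: lt_le_trans de. Qed.

(* If the quasi-component of [M] in the closure of a neighbourhood of [M]
   were [M] itself, a clopen subset squeezed between [M] and the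
   neighbourhood would disconnect [Y]. *)
Lemma boundary_bumping M Y W : M `<=` Y -> ~ Y `<=` M -> open W -> M `<=` W ->
  exists B, [/\ M `<=` B, B `<=` Y, B `<=` closure W & ~ B `<=` M].
Proof.
move=> MY YM oW MW; have [M0 cM coM] := hyperspaceP M.
have [_ cY coY] := hyperspaceP Y.
pose Z := Y `&` closure W.
have cZ : closed Z by apply: closedI => //; exact: closed_closure.
have MZ : M `<=` Z by move=> x Mx; split; [exact: MY|apply: subset_closure; exact: MW].
have Mq : M `<=` quasi_component Z M by move=> x Mx D [_ _ _]; apply.
have qZ : quasi_component Z M `<=` Z.
  by move=> x /(_ Z); apply; split=> //; rewrite setDv; exact: closed0.
have Hq : is_subcontinuum (quasi_component Z M).
  split; first by have [x Mx] := M0; exists x; exact: Mq.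
    by apply: closed_bigI => D [].
  exact: quasi_component_connected.
have [qM|qM] := pselect (quasi_component Z M `<=` M); last first.
  by exists (Hyperspace Hq); split=> //= x /qZ[].
have [D [cD cZD DZ MD] DW] := clopen_around_sub cZ MZ oW (subset_trans qM MW).
have DY : D = Y.
  apply: coY; first by have [x Mx] := M0; exists x; exact: MD.
  (* [D] lies in [W], so being relatively open in [Z] makes it relatively open in [Y]. *)
  - exists (~` (Z `\` D) `&` W); first by apply: openI => //; exact: closed_openC.
    apply/seteqP; split=> x.
      by move=> Dx; split; [case: (DZ _ Dx)|split; [case|exact: DW]].
    move=> [Yx [ZDx Wx]]; apply: contrapT => Dx; apply: ZDx; split=> //.
    by split=> //; exact: subset_closure.
  - by exists D => //; apply/esym/setIidr => x /DZ[].
(* Now [Y] lies in [W], so [Y] itself is a witness. *)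
exists Y; split=> //; rewrite -DY => x /DW; exact: subset_closure.
Qed.

End subcontinua.

(** * Compactness of C(X) and connectedness of its order intervals *)

Section hyperspace.
Context {R : realType} {X : continuumType R}.
Implicit Types (A B M Y : hyperspace X) (U V W Z : set X).

Lemma hausdorff_dist_lt A B (r : R) :
  mdist A B < r <-> exists2 s, s < r & hausdorff_radii A B s.
Proof.
split=> [ABr|[s sr ABs]].
  have rAB : 0 < r - mdist A B by rewrite subr_gt0.
  have [s sAB] := inf_adherent rAB (has_inf_hausdorff_radii A B).
  by rewrite -/(hausdorff_dist _ _) addrC subrK => sr; exists s.
apply: le_lt_trans sr; apply: ge_inf => //.
by exists 0; exact: hausdorff_radii_lbound0.
Qed.

Lemma hausdorff_nbhsP A (P : set (hyperspace X)) :
  nbhs A P <-> exists2 r : R, 0 < r & forall B,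
    A `<=` neighborhood_of r B -> B `<=` neighborhood_of r A -> P B.
Proof.
split=> [/nbhs_ballP[r /= r0 AP]|[r r0 AP]].
  (* The inclusions for a radius bound the infimum only weakly by it; halving gives the strict
     inequality. *)
  exists (r / 2) => [|B AB BA]; first by rewrite divr_gt0.
  apply: AP; rewrite ballEmdist/=; apply/hausdorff_dist_lt; exists (r / 2).
    by rewrite ltr_pdivrMr// ltr_pMr// ltr1n.
  by split => //; rewrite divr_gt0.
apply/nbhs_ballP; exists r => //= B; rewrite ballEmdist/=.
move=> /hausdorff_dist_lt[s /ltW sr [_ AB BA]].
by apply: AP; [apply: subset_trans AB _|apply: subset_trans BA _];
  exact: neighborhood_ofS.
Qed.

(** An ultrafilter [F] converges to its lower limit [L], the points whose neighbourhoods all meet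
    [F]-almost every continuum. As [F] is ultra, a point outside [L] has a neighbourhood missed by
    almost every continuum, so [L] is also the upper limit. It is connected because open sets
    splitting [L] would split some continuum too. *)
Lemma hyperspace_compact : compact [set: hyperspace X].
Proof.
rewrite compact_ultra => F FU _.
pose L : set X :=
  [set x | forall W, nbhs x W ->
    \forall A \near F, (A : hyperspace X) `&` W !=set0].
have cL : closed L.
  move=> x clLx W /nbhs_interior Wx; have [y [Ly Wy]] := clLx _ Wx.
  exact: Ly.
have FL U : open U -> L `<=` U -> \forall A \near F, (A : hyperspace X) `<=` U.
  move=> oU LU.
  have /compact_near_coveringP cUC : compact (~` U).
    by apply: continuum_closed_compact; exact: open_closedC.
  have : \forall A \near F, ~` U `<=` ~` (A : hyperspace X).
    apply: (cUC _ F (fun A x => ~ (A : set X) x)) => x Ux.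
    have /existsNP[W /not_implyP[xW FW]] : ~ L x by move/LU.
    exists (W, ~` [set A : hyperspace X | (A : set X) `&` W !=set0]).
      split => //=.
      by have [] := in_ultra_setVsetC
        [set A : hyperspace X | (A : set X) `&` W !=set0] FU.
    by move=> [y A] /= [Wy AW] Ay; apply: AW; exists y.
  by apply: filterS => A; exact: subsetC2.
(* Compactness of [L] makes the pointwise approximation uniform. *)
have LF (e : R) : 0 < e -> \forall A \near F,
    L `<=` neighborhood_of e (A : hyperspace X).
  move=> e0; have e20 : 0 < e / 2 by rewrite divr_gt0.
  have /compact_near_coveringP := continuum_closed_compact cL.
  apply => x Lx.
  exists (ball x (e / 2),
    [set A : hyperspace X | (A : set X) `&` ball x (e / 2) !=set0]).
    by split; [exact: nbhsx_ballx|apply: Lx; exact: nbhsx_ballx].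
  move=> [y A] /= [xy [a [Aa /ball_sym ax]]]; exists a => //.
  by have := ball_triangle ax xy; rewrite -splitr ballEmdist.
have LC : is_subcontinuum L.
  split => //.
  - apply/set0P/negP => /eqP L0.
    have [|A A0] := @filter_ex _ F _ _ (FL set0 open0 _); first by rewrite L0.
    by have [[a /A0]] := hyperspaceP A.
  - apply: closed_connected => // U V oU oV UV0 LUV [x [Lx Ux]] [y [Ly Vy]].
    have FUV : \forall A \near F, (A : hyperspace X) `<=` U `|` V.
      by apply: FL => //; exact: openU.
    have FxU : \forall A \near F, (A : hyperspace X) `&` U !=set0.
      by apply: Lx; exact: open_nbhs_nbhs.
    have FyV : \forall A \near F, (A : hyperspace X) `&` V !=set0.
      by apply: Ly; exact: open_nbhs_nbhs.
    have [A [AUV [[u [Au Uu]] [v [Av Vv]]]]] :=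
      @filter_ex _ F _ _ (filterI FUV (filterI FxU FyV)).
    have [_ _ coA] := hyperspaceP A.
    have [AU|AV] :=
      connected_subset (open_disjoint_separated oU oV UV0) AUV coA.
    + by rewrite -[False]/(set0 v) -UV0; split; first exact: AU.
    + by rewrite -[False]/(set0 u) -UV0; split; last exact: AV.
exists (Hyperspace LC); split => // P /hausdorff_nbhsP[r r0 LP].
have : \forall A \near F, (A : hyperspace X) `<=` neighborhood_of r L.
  by apply: FL; [exact: open_neighborhood_of|exact: sub_neighborhood_of].
by move=> /(filterI (LF _ r0)); apply: filterS => A [LA AL]; exact: LP.
Qed.

Lemma closed_superset (A : set X) : closed [set B : hyperspace X | A `<=` B].
Proof.
move=> B clB x Ax; have [_ cB _] := hyperspaceP B; apply: cB => W.
move=> /nbhs_ballP[e /= e0 xW].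
have [|C [AC]] := clB [set C | (C : set X) `<=` neighborhood_of e B].
  by apply/hausdorff_nbhsP; exists e.
move=> /(_ _ (AC _ Ax))[b Bb bx]; exists b; split => //.
by apply: xW; apply: ball_sym; rewrite ballEmdist.
Qed.

Lemma closed_subset Z : closed Z -> closed [set B : hyperspace X | (B : set X) `<=` Z].
Proof.
move=> cZ B clB x Bx; apply: cZ => W.
move=> /nbhs_ballP[e /= e0 xW].
have [|C [CZ]] := clB [set C | (B : set X) `<=` neighborhood_of e C].
  by apply/hausdorff_nbhsP; exists e.
move=> /(_ _ Bx)[b Cb bx]; exists b; split => //; first exact: CZ.
by apply: xW; apply: ball_sym; rewrite ballEmdist.
Qed.

(** Zorn's lemma above [A]: a chain is bounded by a cluster point of its filter of tails, since [Q]
    and the sets of continua containing a given one are closed. *)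
Lemma closed_has_maximal (Q : set (hyperspace X)) A : closed Q -> Q A ->
  exists M, [/\ Q M, A `<=` M & forall B, Q B -> M `<=` B -> B `<=` M].
Proof.
move=> cQ QA.
pose T := {B : hyperspace X | Q B /\ A `<=` B}.
pose mk B QB AB : T := exist _ B (conj QB AB).
pose le (B C : T) := `[< (sval B : set X) `<=` sval C >].
have [|||[M [QM AM]] maxM] := @ZL_preorder T (mk A QA (@subset_refl _ A)) le.
- by move=> B; apply/asboolP.
- by move=> C B D /asboolP BC /asboolP CD; apply/asboolP/(subset_trans BC).
- move=> S totS; have [[B0 SB0]|S0] := pselect (S !=set0); last first.
    by exists (mk A QA (@subset_refl _ A)) => B SB; case: S0; exists B.
  pose F := filter_from S (fun B : T => [set C : hyperspace X | Q C /\ sval B `<=` C]).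
  have FF : ProperFilter F.
    apply: filter_from_proper; last first.
      by move=> B _; exists (sval B); split => //; case: (svalP B).
    apply: filter_from_filter; first by exists B0.
    move=> B C SB SC.
    have [/asboolP BC|/asboolP CB] := totS _ _ SB SC; [exists C|exists B] => //;
      by move=> D [QD CD]; split; split=> //; exact: subset_trans CD.
  have [//|C [_ clC]] := hyperspace_compact FF; first exact: filterT.
  have FC D : closed D -> F D -> D C.
    by move=> cD FD; rewrite ((closure_id _).1 cD) => V; exact: clC.
  have QC : Q C by apply: FC => //; exists B0 => // D [].
  have SC (B : T) : S B -> sval B `<=` C.
    move=> SB; apply: (FC [set D : hyperspace X | (sval B : set X) `<=` D]).
      exact: closed_superset.
    by exists B => // D [].
  have AC : A `<=` C by apply: subset_trans (SC _ SB0); case: (svalP B0).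
  exists (mk C QC AC) => B SB; apply/asboolP; exact: SC.
exists M; split=> // B QB MB.
by have /asboolP := maxM (mk B QB (subset_trans AM MB)) (asboolT MB).
Qed.

Lemma interval_connected A Y :
  connected [set B : hyperspace X | A `<=` B /\ B `<=` Y].
Proof.
set I := [set B | _]; have cI : closed I.
  apply: closedI; first exact: closed_superset.
  by apply: closed_subset; case: (hyperspaceP Y).
apply: contrapT => /(closed_not_connected cI)[P [Q [cP cQ P0 Q0 [IPQ PQ0]]]].
(* The interval is nonempty, hence contains [Y]. *)
wlog PY : P Q cP cQ P0 Q0 IPQ PQ0 / P Y.
  move=> wl; have [B PB] := P0.
  have [_ BY] : I B by rewrite IPQ; left.
  have : I Y by split=> //; apply: subset_trans BY; have [] : I B by rewrite IPQ; left.
  rewrite IPQ => -[PY|QY]; first exact: (wl P Q).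
  by apply: (wl Q P) => //; rewrite 1?setUC 1?setIC.
have [B QB] := Q0.
have [M [QM BM maxM]] := closed_has_maximal cQ QB.
have IM : I M by rewrite IPQ; right.
have [AM MY] := IM.
have /hausdorff_nbhsP[r r0 MP] : nbhs M (~` P).
  apply: open_nbhs_nbhs; split; first exact: closed_openC.
  by move=> PM; rewrite -[False]/(set0 M) -PQ0.
have YM : ~ Y `<=` M.
  move=> YM; have MYE : M = Y by apply/hyperspace_inj/seteqP.
  by rewrite -[False]/(set0 M) -PQ0; split=> //; rewrite MYE.
(* Bumping stays only in the closure of the neighbourhood used; radius [r / 2] keeps that closure
   within [r] of [M]. *)
have r20 : 0 < r / 2 by rewrite divr_gt0.
have [N [MN NY Nr NM]] :=
  boundary_bumping MY YM (@open_neighborhood_of _ _ (r / 2) M)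
  (@sub_neighborhood_of _ _ _ M r20).
have : I N by split=> //; exact: subset_trans MN.
rewrite IPQ => -[|QN]; last by apply: NM; exact: maxM.
apply: MP.
  by move=> x /MN Nx; apply: sub_neighborhood_of.
move=> x /Nr /(_ (ball x (r / 2))) [|y [[m Mm my] xy]].
  exact: nbhsx_ballx.
exists m => //; rewrite (splitr r); apply: le_lt_trans (metric_triangle m y x) _.
by rewrite ltrD//; move/ball_sym: xy; rewrite ballEmdist.
Qed.

End hyperspace.

(** * Colocal connectedness in a quotient collapsing one set *)

Section collapse.
Context {T : topologicalType} (S : set T).

Definition collapse_pi : T -> collapse S := \pi_(collapse S).

Lemma collapse_pi_surj y : exists x, collapse_pi x = y.
Proof. by exists (repr y); exact: reprK. Qed.

Lemma collapse_piP x y : collapse_pi x = collapse_pi y <-> x = y \/ S x /\ S y.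
Proof.
split=> [xy|xy]; last by apply/eqmodP/asboolP.
by have /asboolP : collapse_equiv S x y by apply/eqmodP; exact: xy.
Qed.

Lemma collapse_pi_connected (C : set T) :
  connected C -> connected (collapse_pi @` C).
Proof.
move=> cC; apply: connected_continuous_connected => //.
exact/continuous_subspaceT/pi_continuous.
Qed.

(** The test is carried out upstairs. A [V] that contains or misses [S] is saturated, so its image
    is open and has as complement the image of the complement of [V]. *)
Lemma colocally_connected_collapse x :
  (forall U, open U -> U x -> (S x -> S `<=` U) ->
    exists V, [/\ open V, V x, V `<=` U, S `<=` V \/ S `&` V = set0 &
      connected (collapse_pi @` (~` V))]) ->
  colocally_connected_at (collapse_pi x).
Proof.
move=> HS U oU Ux.
have [|||V [oV Vx VU SV coV]] := HS (collapse_pi @^-1` U) => //.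
  move=> Sx y Sy /=; suff -> : collapse_pi y = collapse_pi x by [].
  by apply/collapse_piP; right.
have satV y z : collapse_pi y = collapse_pi z -> V y -> V z.
  move=> /collapse_piP[<-//|[Sy Sz] Vy]; case: SV => [/(_ _ Sz)//|SV0].
  by exfalso; rewrite -[False]/(set0 y) -SV0.
have preV : collapse_pi @^-1` (collapse_pi @` V) = V.
  apply/seteqP; split=> [y [z Vz zy]|y Vy]; first exact: satV Vz.
  by exists y.
exists (collapse_pi @` V); split.
- rewrite /open/= /quotient_open.
  by rewrite -[X in open X]/(collapse_pi @^-1` (collapse_pi @` V)) preV.
- by exists x.
- by move=> _ [y /VU Uy <-].
- suff -> : ~` (collapse_pi @` V) = collapse_pi @` (~` V) by [].
  apply/seteqP; split=> [y Vy|_ [y Vy <-] [z Vz zy]].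
    have [z zy] := collapse_pi_surj y; exists z => // Vz.
    by apply: Vy; exists z.
  by apply: Vy; apply: satV Vz.
Qed.

End collapse.

(** * Colocal connectedness of HS(p, X) at the vertex and off it *)

Section HS.
Context {R : realType} {X : continuumType R} (p : X).
Implicit Types (A B M Y : hyperspace X) (U V W Z : set X).
Local Notation pi := (collapse_pi (hyperspace_at p)).

Lemma is_subcontinuum1 (x : X) : is_subcontinuum [set x].
Proof.
split; [by exists x|apply: accessible_closed_set1|exact: connected1].
exact/hausdorff_accessible/metric_hausdorff.
Qed.

Definition singleton (x : X) : hyperspace X := Hyperspace (is_subcontinuum1 x).

Lemma singleton_continuous : continuous singleton.
Proof.
move=> x P /hausdorff_nbhsP[r r0 xP].
apply/nbhs_ballP; exists r => //= y; rewrite ballEmdist/= => xy.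
apply: xP => _ ->; [exists y|exists x] => //.
by rewrite metric_sym.
Qed.

Lemma singletons_connected : connected (range singleton).
Proof.
apply: connected_continuous_connected; first exact: continuum_connected.
exact/continuous_subspaceT/singleton_continuous.
Qed.

Lemma is_subcontinuumT : is_subcontinuum [set: X].
Proof.
by split; [exists p|exact: closedT|exact: continuum_connected].
Qed.

Definition whole : hyperspace X := Hyperspace is_subcontinuumT.

(** For nonempty [Z] this is a union of intervals sharing the top element [Z]. Empty [Z] is allowed
    because the complement of a neighbourhood of [p] may be empty. *)
Lemma subcontinua_connected Z : closed Z -> connected Z ->
  connected [set A : hyperspace X | (A : set X) `<=` Z].
Proof.
move=> cZ coZ; have [Z0|/set0P Z0] := eqVneq Z set0.
  rewrite (_ : [set _ | _] = set0); first exact: connected0.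
  rewrite -subset0 => A /=; rewrite Z0 => A0.
  by have [[a /A0]] := hyperspaceP A.
pose Y := Hyperspace (And3 Z0 cZ coZ).
rewrite (_ : [set _ | _] = \bigcup_(A in
    [set A : hyperspace X | (A : set X) `<=` Z])
  [set B : hyperspace X | A `<=` B /\ B `<=` Y]).
  apply: bigcup_connected => [|A _]; last exact: interval_connected.
  by exists Y => A AZ; split.
apply/seteqP; split=> [A AZ|B [A _ []]//].
by exists A => //; split.
Qed.

Lemma colocally_connected_at_vertex : colocally_connected_at p ->
  colocally_connected_at (pi (singleton p)).
Proof.
move=> hp; apply: colocally_connected_collapse => U oU _.
move=> /(_ erefl) pU.
have /compact_near_coveringP cUC : compact (~` U).
  by apply: subclosed_compact hyperspace_compact _ => //; exact: open_closedC.
(* Each continuum outside [U] misses [p]; compactness of the complement of [U] yields one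
   neighbourhood of [p] missed by all of them. *)
have : \forall x \near p, ~` U `<=` [set A : hyperspace X | ~ (A : set X) x].
  apply: (cUC _ (nbhs p) (fun x A => ~ (A : set X) x)) => A UA.
  have pA : ~ (A : set X) p by move/pU.
  have [_ cA _] := hyperspaceP A.
  have [r r0 pr] : exists2 r : R, 0 < r & ball p r `<=` ~` A.
    apply/nbhs_ballP; apply: open_nbhs_nbhs; split=> //; exact: closed_openC.
  have r20 : 0 < r / 2 by rewrite divr_gt0.
  exists ([set B : hyperspace X | (B : set X) `<=` neighborhood_of (r / 2) A],
    ball p (r / 2)).
    split; last exact: nbhsx_ballx.
    by apply/hausdorff_nbhsP; exists (r / 2).
  move=> [B x] /= [BA px] /BA[a Aa ax]; apply: (pr a) => //.
  rewrite (splitr r); apply: ball_triangle px _; apply: ball_sym.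
  by rewrite ballEmdist.
move=> pUC.
have [V0 [oV0 V0p V0U coV0]] := hp _ (@open_interior _ _) pUC.
exists (~` [set A : hyperspace X | (A : set X) `<=` ~` V0]); split.
- by apply: closed_openC; apply: closed_subset; exact: open_closedC.
- by move=> /(_ p erefl).
- move=> A; apply: contra_notP => UA x Ax V0x.
  by have /interior_subset UCx := V0U _ V0x; have /= := UCx A UA; exact.
- by left=> A Ap /(_ _ Ap).
- rewrite setCK; apply: collapse_pi_connected; apply: subcontinua_connected => //.
  exact: open_closedC.
Qed.

Lemma colocally_connected_at_off_vertex A : ~ (A : set X) p ->
  colocally_connected_at (pi A).
Proof.
move=> Ap; have [[a Aa] cA coA] := hyperspaceP A.
apply: colocally_connected_collapse => U oU UA _.
(* [r1] keeps the ball in [U], [r2] keeps it off C(p, X), so that it is saturated, and [r3] keeps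
   singletons out of it when [A] is nondegenerate. *)
have [r1 r10 r1U] : exists2 r : R, 0 < r & ball A r `<=` U.
  by apply/nbhs_ballP; exact: open_nbhs_nbhs.
have [r2 r20 r2A] : exists2 r : R, 0 < r & ball p r `<=` ~` A.
  apply/nbhs_ballP; apply: open_nbhs_nbhs; split=> //; exact: closed_openC.
have [r3 r30 r3A] : exists2 r : R, 0 < r & (A : set X) `<=` [set a] \/
    exists2 b, (A : set X) b & r + r <= mdist a b.
  have [Aa1|] := pselect ((A : set X) `<=` [set a]); first by exists 1 => //; left.
  move=> /existsNP[b /not_implyP[Ab ba]]; exists (mdist a b / 2).
    by rewrite divr_gt0// mdist_gt0 eq_sym; exact/eqP.
  by right; exists b => //; rewrite -splitr.
pose r := Num.min r1 (Num.min r2 r3).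
have r0 : 0 < r by rewrite !lt_min r10 r20.
have rr1 : r <= r1 by rewrite ge_min lexx.
have rr2 : r <= r2 by rewrite !ge_min lexx orbT.
have rr3 : r <= r3 by rewrite !ge_min lexx !orbT.
exists (ball A r); split.
- exact: open_metric_ball.
- exact: ballxx.
- by apply: subset_trans r1U; exact: le_ball.
- right; rewrite -subset0 => B [Bp]; rewrite ballEmdist/=.
  move=> /hausdorff_dist_lt[s sr [s0 _ /(_ _ Bp)[b Ab bp]]].
  apply: (r2A b) => //; rewrite ballEmdist/= metric_sym.
  by apply: lt_trans bp _; exact: lt_le_trans rr2.
(* The first alternative is inherited by larger continua, the second by smaller
   ones. *)
have far B : ~ ball A r B ->
    (forall s, 0 < s < r -> ~ B `<=` neighborhood_of s A) \/
    (forall s, 0 < s < r -> ~ A `<=` neighborhood_of s B).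
  move=> AB; apply: contrapT => /not_orP[].
  move=> /existsNP[s /not_implyP[/andP[s0 sr]]] /contrapT BA.
  move=> /existsNP[t /not_implyP[/andP[t0 tr]]] /contrapT AB'.
  apply: AB; rewrite ballEmdist/=; apply/hausdorff_dist_lt.
  exists (Num.max s t); first by rewrite gt_max sr tr.
  split; first by rewrite lt_max s0.
  - by apply: subset_trans AB' _; apply: neighborhood_ofS; rewrite le_max lexx orbT.
  - by apply: subset_trans BA _; apply: neighborhood_ofS; rewrite le_max lexx.
have inball B : ball A r B -> exists2 s, 0 < s < r &
    B `<=` neighborhood_of s A /\
    A `<=` neighborhood_of s B.
  rewrite ballEmdist/= => /hausdorff_dist_lt[s sr [s0 AB BA]].
  by exists s; rewrite ?s0.
pose vertex := pi (singleton p).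
pose joins (C : set (hyperspace X)) B :=
  [/\ C B, C `<=` ~` ball A r, connected (pi @` C) & (pi @` C) vertex].
(* The image of the complement of the ball is then a union of connected sets through the vertex. *)
suff H B : ~ ball A r B -> exists C, joins C B.
  have /choice[C HC] : forall B, exists C, ~ ball A r B -> joins C B.
    (* [set0] is a dummy value: the union below ranges over [B] outside the ball. *)
    move=> B; have [AB|/H[C HC]] := pselect (ball A r B); first by exists set0.
    by exists C.
  rewrite (_ : _ @` _ = \bigcup_(B in ~` ball A r) (pi @` (C B))).
    apply: bigcup_connected; first by exists vertex => B /HC[].
    by move=> B /HC[].
  apply/seteqP; split=> [_ [B AB <-]|_ [B AB [D CD <-]]].
    by exists B => //; exists B => //; case: (HC B AB).
  by exists D => //; case: (HC B AB) => _ + _ _; apply.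
have vertexT : pi whole = vertex by apply/collapse_piP; right.
have up : (forall s, 0 < s < r -> ~ B `<=` neighborhood_of s A) ->
    exists C, joins C B.
  move=> BA; exists [set D : hyperspace X | B `<=` D /\ D `<=` whole]; split.
  - by split.
  - move=> D [BD _] /inball[s sr [DA _]]; apply: (BA s sr).
    exact: subset_trans DA.
  - exact/collapse_pi_connected/interval_connected.
  - by exists whole.
move=> /far[|AB]; first exact: up.
case: r3A => [Aa1|[c Ac ac]].
  (* If [A] is a singleton, [B] close to [A] has a point near [a], so [A] is close to [B]. *)
  apply: up => s sr BA.
  apply: (AB s sr) => x /Aa1 ->.
  have [[b Bb] _ _] := hyperspaceP B.
  have [x' /Aa1 -> xb] := BA _ Bb.
  by exists b => //; rewrite metric_sym.
have [[b Bb] _ _] := hyperspaceP B.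
(* The two pieces meet at the singleton of [b]. *)
exists (range singleton `|`
  [set D : hyperspace X | singleton b `<=` D /\ D `<=` B]); split.
- by right; split => // _ ->.
(* A singleton of [x] in the ball would put both [a] and [c] within [r] of [x], although they are at
   least [r3 + r3] apart. *)
- move=> D [[x _ <-]|[_ DB]] /inball[s sr [DA AD]].
    have [_ -> xa] := AD _ Aa; have [_ -> xc] := AD _ Ac.
    have : mdist a c < r + r.
      apply: le_lt_trans (metric_triangle a x c) _; rewrite metric_sym.
      by case/andP: sr => _ sr; rewrite ltrD// (lt_trans _ sr).
    by rewrite ltNge (le_trans _ ac)// lerD.
  apply: (AB s sr) => x /AD[d /DB Bd dx]; by exists d.
- apply: collapse_pi_connected; apply: connectedU.
  + by exists (singleton b); split; [exists b|split=> // _ ->].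
  + exact: singletons_connected.
  + exact: interval_connected.
- by exists (singleton p) => //; left; exists p.
Qed.

End HS.

Theorem theorem9p1 (R : realType) (X : continuumType R) (p : X)
  (hp : colocally_connected_at p) : colocally_connected (HS p).
Proof.
move=> y; have [A <-] := collapse_pi_surj y.
have [Ap|Ap] := pselect ((A : set X) p); last first.
  exact: colocally_connected_at_off_vertex.
suff -> : collapse_pi (hyperspace_at p) A =
         collapse_pi (hyperspace_at p) (singleton p).
  exact: colocally_connected_at_vertex.
by apply/collapse_piP; right.
Qed.
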